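(* Let $E,J,R\in\mathbb{C}^{n,n}$ and $B\in\mathbb{C}^{n,m}$ with $E=E^H\ge 0$, $R=R^H\ge 0$, $J=-J^H$ and $B$ of full column rank (the coefficients of a port-Hamiltonian descriptor system $E\dot x=(J-R)x+Bu$, $y=B^Hx$). There exist matrices $K,F_S,F_H\in\mathbb{C}^{m,m}$ with $F_S=-F_S^H$, $F_H=F_H^H$ such that the pair $(E+BKB^H,\;J+BF_SB^H-(R+BF_HB^H))$ is regular, of index at most one, has all its finite eigenvalues in the open left complex half plane, and $$E+BKB^H\ge 0,\qquad R+BF_HB^H\ge 0,$$ if and only if the following three conditions hold: (a) $\operatorname{rank}\begin{bmatrix}E & J-R & B\end{bmatrix}=n$; (b) $\operatorname{rank}\Big(\mathcal{T}_\infty^H(B)\,E\,\mathcal{S}_\infty\big(\mathcal{T}_\infty^H(\begin{bmatrix}E & B\end{bmatrix})(J-R)\big)\Big)=\operatorname{rank}\begin{bmatrix}E & B\end{bmatrix}-\operatorname{rank}(B)$; (c) $\operatorname{rank}\begin{bmatrix}J-R-sE & B\end{bmatrix}=n$ for all purely imaginary $s\in\mathbb{C}$. Moreover, if (a), (b), (c) hold, then for a given integer $r$ there exist matrices $K$, $F_S=-F_S^H$, $F_H=F_H^H$ in $\mathbb{C}^{m,m}$ such that the pair $(E+BKB^H,\;(J+BF_SB^H)-(R+BF_HB^H))$ is regular, of index at most one, has all its finite eigenvalues in the open left complex half plane, $E+BKB^H\ge 0$, $R+BF_HB^H\ge 0$, and $\operatorname{rank}(E+BKB^H)=r$, if and only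 if $$\operatorname{rank}\begin{bmatrix}E & B\end{bmatrix}-\operatorname{rank}(B)\;\le\; r\;\le\;\operatorname{rank}\left(\mathcal{T}_\infty^H\!\left((J-R)\,\mathcal{S}_\infty\!\left(\begin{bmatrix}E\\ B^H\end{bmatrix}\right)\right)\begin{bmatrix}E & B\end{bmatrix}\right).$$
   Context: $\mathbb{C}^{p,q}$ denotes the complex $p\times q$ matrices. $M\ge 0$ ($M>0$) means that $M$ is Hermitian positive semidefinite (positive definite). A pair $(E,A)$ of square matrices (identified with the pencil $\lambda E-A$) is regular if $\det(\lambda_0E-A)\ne 0$ for some $\lambda_0\in\mathbb{C}$. The finite eigenvalues of a regular pair are the $\lambda_0\in\mathbb{C}$ with $\det(\lambda_0E-A)=0$. The index of a regular pair is the size of the largest Jordan block associated with the eigenvalue $\infty$ in its Kronecker (Weierstrass) canonical form, and is $0$ if $E$ is invertible. $\mathcal{S}_\infty(M)$ denotes a full column rank matrix whose columns span the right nullspace of $M$; $\mathcal{T}_\infty(M)$ denotes a full column rank matrix whose columns span the left nullspace of $M$ (so $\mathcal{T}_\infty(M)^HM=0$), and $\mathcal{T}_\infty^H(M)=(\mathcal{T}_\infty(M))^H$. Trivial nullspaces give empty matrices, which have rank $0$. Purely imaginary $s$ means $\Re(s)=0$, including $s=0$. *)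

(* Defs.v *)
From mathcomp Require Import all_boot all_order all_algebra.
From mathcomp Require Import sesquilinear spectral complex reals.

Set Implicit Arguments.
Unset Strict Implicit.
Unset Printing Implicit Defensive.

Import Order.TTheory GRing.Theory Num.Theory.
Local Open Scope ring_scope.
Local Open Scope sesquilinear_scope.
Local Open Scope complex_scope.

(* The field of complex numbers is R[i] for R : realType, and M^t* is the
   conjugate transpose of M. *)

(* In R[i], 0 <= z means that z is real and nonnegative. *)
Definition psdmx (R : realType) (n : nat) (M : 'M[R[i]]_n) : Prop :=
  M = M ^t* /\ forall x : 'cV[R[i]]_n, 0 <= (x ^t* *m M *m x) 0 0.

(* S is one of the matrices S_oo(M); k = 0 is the empty matrix. *)
Definition right_null_basis (R : realType) (p q k : nat)
    (M : 'M[R[i]]_(p, q)) (S : 'M[R[i]]_(q, k)) : Prop :=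
  \rank S = k /\
  forall x : 'cV[R[i]]_q, M *m x = 0 <-> exists y : 'cV[R[i]]_k, x = S *m y.

(* T is one of the matrices T_oo(M). *)
Definition left_null_basis (R : realType) (p q k : nat)
    (M : 'M[R[i]]_(p, q)) (T : 'M[R[i]]_(p, k)) : Prop :=
  \rank T = k /\
  forall x : 'cV[R[i]]_p,
    x ^t* *m M = 0 <-> exists y : 'cV[R[i]]_k, x = T *m y.

Definition regular_pair (R : realType) (n : nat) (E A : 'M[R[i]]_n) : Prop :=
  exists l : R[i], \det (l *: E - A) != 0.

Definition finite_eigenvalue (R : realType) (n : nat) (E A : 'M[R[i]]_n)
    (l : R[i]) : Prop :=
  \det (l *: E - A) = 0.

Definition jordan_block (R : realType) (a : R[i]) (k : nat) : 'M[R[i]]_k :=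
  \matrix_(i, j) (if i == j then a else (i.+1 == j :> nat)%:R).

(* E = P diag(I, N) Q and A = P diag(J, I) Q with P, Q invertible, J the direct
   sum of the Jordan blocks of size p i for a i, and N the direct sum of the
   nilpotent Jordan blocks of size q j (the blocks at infinity). *)
Definition weierstrass_form (R : realType) (n : nat) (E A : 'M[R[i]]_n)
    (k : nat) (p : 'I_k -> nat) (a : 'I_k -> R[i])
    (l : nat) (q : 'I_l -> nat) : Prop :=
  [/\ forall i, (0 < p i)%N, forall j, (0 < q j)%N &
      exists (e : (\sum_i p i + \sum_j q j = n)%N) (P Q : 'M[R[i]]_n),
        [/\ P \in unitmx, Q \in unitmx,
            E = P *m castmx (e, e)
                  (block_mx 1%:M 0 0 (\mxdiag_j jordan_block 0 (q j))) *m Q &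
            A = P *m castmx (e, e)
                  (block_mx (\mxdiag_i jordan_block (a i) (p i)) 0 0 1%:M)
                  *m Q]].

(* The maximum over the empty family (E invertible) is 0. *)
Definition pencil_index (R : realType) (n : nat) (E A : 'M[R[i]]_n)
    (nu : nat) : Prop :=
  exists (k : nat) (p : 'I_k -> nat) (a : 'I_k -> R[i])
         (l : nat) (q : 'I_l -> nat),
    weierstrass_form E A p a q /\ nu = (\max_j q j)%N.

Definition stabilizing_feedback (R : realType) (n m : nat)
    (E J Rd : 'M[R[i]]_n) (B : 'M[R[i]]_(n, m)) (K FS FH : 'M[R[i]]_m) : Prop :=
  let Ecl := E + B *m K *m B ^t* in
  let Rcl := Rd + B *m FH *m B ^t* in
  let Acl := J + B *m FS *m B ^t* - Rcl in
  [/\ FS = - FS ^t* /\ FH = FH ^t*,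
      regular_pair Ecl Acl,
      exists2 nu : nat, pencil_index Ecl Acl nu & (nu <= 1)%N,
      forall l : R[i], finite_eigenvalue Ecl Acl l -> complex.Re l < 0 &
      psdmx Ecl /\ psdmx Rcl].

(* Main.v *)
Require Import Defs.
From mathcomp Require Import all_boot all_order all_algebra.
From mathcomp Require Import sesquilinear spectral complex reals.
From mathcomp Require Import zify ring.

Set Implicit Arguments.
Unset Strict Implicit.
Unset Printing Implicit Defensive.

Import Order.TTheory GRing.Theory Num.Theory.
Local Open Scope ring_scope.
Local Open Scope sesquilinear_scope.
Local Open Scope complex_scope.

(* A pencil s E - A is regular of index at most one iff E x = 0 and
   A x \in range E imply x = 0: a rank factorization of E and a Schur complement
   in A leave a finite part, which is brought to Jordan form.

   Choose coordinates with B = [I; 0] and, after a congruence and a shift of E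
   by B K B^*, E = diag(0, I, 0); write A = J - R in the corresponding 3 x 3
   blocks.  The feedback changes only the (1,1) blocks, and the closed-loop E is
   diag(K1, I, 0) with K1 >= 0.  Conditions (a) and (b) together say that
   [A31 A33] has full row rank.  Dissipativity gives ker A33 = ker A33^*, so the
   index condition reduces to A13 being injective on ker A33 modulo the range of
   K1; a K1 of rank rho with that property exists iff rho <= m - dim (ker A33),
   which is the upper bound on the rank.  With F_S = 0 and F_H = I, an
   eigenvector x of the closed loop with eigenvalue in the closed right half
   plane satisfies R x = 0 and B^* x = 0, and is excluded by (c). *)

(** * Adjoints and positive semidefinite matrices *)

Section Adjoint.
Variable (C : numClosedFieldType).

Lemma ctM m n p (A : 'M[C]_(m, n)) (B : 'M[C]_(n, p)) :
  (A *m B) ^t* = B ^t* *m A ^t*.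
Proof. by rewrite trmx_mul map_mxM. Qed.

Lemma ctD m n (A B : 'M[C]_(m, n)) : (A + B) ^t* = A ^t* + B ^t*.
Proof. by rewrite linearD /= map_mxD. Qed.

Lemma ctN m n (A : 'M[C]_(m, n)) : (- A) ^t* = - A ^t*.
Proof. by rewrite linearN /= map_mxN. Qed.

Lemma ctZ m n a (A : 'M[C]_(m, n)) : (a *: A) ^t* = a^* *: A ^t*.
Proof. by rewrite linearZ /= map_mxZ. Qed.

Lemma ct0 m n : (0 : 'M[C]_(m, n)) ^t* = 0.
Proof. by rewrite trmx0 map_mx0. Qed.

Lemma ct1 n : (1%:M : 'M[C]_n) ^t* = 1%:M.
Proof. by rewrite trmx1 map_mx1. Qed.

Lemma ct_inj m n : injective (fun A : 'M[C]_(m, n) => A ^t*).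
Proof. by move=> A B h; rewrite -[A]trmxCK -[B]trmxCK h. Qed.

Lemma ct_eq0 m n (A : 'M[C]_(m, n)) : A ^t* = 0 -> A = 0.
Proof. by move=> h; apply: ct_inj; rewrite h ct0. Qed.

Lemma rank_ct m n (A : 'M[C]_(m, n)) : \rank (A ^t*) = \rank A.
Proof. by rewrite mxrank_map mxrank_tr. Qed.

Lemma ct_row_mx m n p (A : 'M[C]_(m, n)) (B : 'M[C]_(m, p)) :
  (row_mx A B) ^t* = col_mx (A ^t*) (B ^t*).
Proof. by rewrite tr_row_mx map_col_mx. Qed.

Lemma ct_col_mx m n p (A : 'M[C]_(m, n)) (B : 'M[C]_(p, n)) :
  (col_mx A B) ^t* = row_mx (A ^t*) (B ^t*).
Proof. by rewrite tr_col_mx map_row_mx. Qed.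

Lemma mx11_eq0 (a : 'M[C]_1) : a 0 0 = 0 -> a = 0.
Proof. by move=> h; apply/matrixP => i j; rewrite !ord1 h mxE. Qed.

Lemma sqnorm_ge0 n (x : 'cV[C]_n) : 0 <= (x ^t* *m x) 0 0.
Proof.
by rewrite mxE sumr_ge0 // => i _; rewrite !mxE mulrC mul_conjC_ge0.
Qed.

Lemma sqnorm_eq0 n (x : 'cV[C]_n) : x ^t* *m x = 0 -> x = 0.
Proof.
move/matrixP/(_ 0 0); rewrite !mxE => /eqP; rewrite psumr_eq0; last first.
  by move=> i _; rewrite !mxE mulrC mul_conjC_ge0.
move/allP => h; apply/colP => i; rewrite mxE; apply/eqP.
by have := h i (mem_index_enum _); rewrite !mxE mulrC mul_conjC_eq0.
Qed.

(** For each column x of X, x^* L^* L x is the squared norm of L x. *)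
Lemma gram_eq0 m n p (L : 'M[C]_(m, n)) (X : 'M_(n, p)) :
  L ^t* *m L *m X = 0 -> L *m X = 0.
Proof.
move=> h; apply/matrixP => i j; rewrite [RHS]mxE.
suff : L *m col j X = 0 by move/matrixP/(_ i 0); rewrite colE mulmxA -colE !mxE.
apply: sqnorm_eq0; rewrite ctM -mulmxA (mulmxA (L ^t*)).
by rewrite colE (mulmxA (L ^t* *m L)) h mul0mx mulmx0.
Qed.

Lemma rank_gram_mul m n p (L : 'M[C]_(m, n)) (X : 'M_(n, p)) :
  \rank (L ^t* *m L *m X) = \rank (L *m X).
Proof.
apply/eqP; rewrite eqn_leq -{1}mulmxA mxrankM_maxr /=.
have : L *m X *m cokermx (L ^t* *m L *m X) = 0.
  by rewrite -mulmxA; apply: gram_eq0; rewrite mulmxA mulmx_coker.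
move/mulmx0_rank_max; rewrite mxrank_coker.
by have := rank_leq_col (L ^t* *m L *m X); lia.
Qed.

Lemma rank_gram m n (L : 'M[C]_(m, n)) : \rank (L ^t* *m L) = \rank L.
Proof. by rewrite -[L ^t* *m L]mulmx1 rank_gram_mul mulmx1. Qed.

Lemma exists_unitarymx_eqmx m n (A : 'M[C]_(m, n)) :
  exists2 U : 'M_(\rank A, n), U *m U ^t* = 1%:M & (U :=: A)%MS.
Proof.
exists (schmidt (row_base A)).
  by apply/unitarymxP/schmidt_unitarymx/rank_leq_col.
exact: eqmx_trans (eqmx_schmidt_free (row_base_free A)) (eq_row_base A).
Qed.

(** U^* U is the orthogonal projection attached to the row space of U, so it fixes the adjoints of
    rows lying there. *)
Lemma unitary_projK r m n (U : 'M[C]_(r, n)) (Y : 'M_(m, n)) :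
  U *m U ^t* = 1%:M -> (Y <= U)%MS -> U ^t* *m (U *m Y ^t*) = Y ^t*.
Proof.
move=> UU /submxP[X ->].
by rewrite ctM (mulmxA U) UU mul1mx.
Qed.

Lemma exists_row_free_sub (F : fieldType) r m n (X : 'M[F]_(m, n)) :
  (r <= \rank X)%N -> exists2 D : 'M_(r, n), row_free D & (D <= X)%MS.
Proof.
move=> hr; exists (pid_mx r *m row_base X).
  by rewrite /row_free mxrankMfree ?row_base_free // rank_pid_mx.
by rewrite mulmx_sub // eq_row_base.
Qed.

(** The columns of [cokermx P] serve as test vectors y. This duality converts inclusions of row
    spaces into statements about right null vectors. *)
Lemma submx_kerP (F : fieldType) m1 m2 n (a : 'M[F]_(m1, n)) (P : 'M_(m2, n)) :
  (forall y : 'cV_n, P *m y = 0 -> a *m y = 0) -> (a <= P)%MS.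
Proof.
move=> h; rewrite submxE; apply/eqP/matrixP => i j.
have : a *m (cokermx P *m (delta_mx j 0 : 'cV_n)) = 0.
  by apply: h; rewrite mulmxA mulmx_coker mul0mx.
by rewrite mulmxA -colE => /matrixP/(_ i 0); rewrite !mxE.
Qed.

Lemma rank_eq_dim (F : fieldType) n k (M : 'M[F]_(n, k)) :
  \rank M = n <-> forall u : 'rV_n, u *m M = 0 -> u = 0.
Proof.
split=> [h u hu|h].
  have fM : row_free M by rewrite /row_free h.
  by apply: (row_free_inj fM); rewrite hu mul0mx.
apply/eqP; rewrite -[_ == _]/(row_free M) -kermx_eq0.
by apply/rowV0P => u /sub_kermxP; apply: h.
Qed.

(** Adding the equation to its conjugate cancels the skew term j and leaves a vanishing sum of
    nonnegative terms. *)
Lemma quad_sign (l e j q : C) :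
  0 <= e -> 0 <= q -> j^*%R = - j -> 0 <= l + l^*%R -> l * e - j + q = 0 ->
  (l + l^*%R) * e = 0 /\ q = 0.
Proof.
move=> he hq hj hl h1.
have h2 : l^*%R * e + j + q = 0.
  have := congr1 (fun z => z^*%R) h1.
  rewrite /= rmorph0 !rmorphD rmorphN rmorphM /= hj opprK.
  by rewrite (geC0_conj he) (geC0_conj hq).
have : (l + l^*%R) * e + (q + q) = 0.
  by rewrite -[RHS]addr0 -[X in _ = X + _]h1 -[X in _ = _ + X]h2; ring.
have le_ge0 := mulr_ge0 hl he.
move/eqP; rewrite paddr_eq0 ?addr_ge0 // paddr_eq0 //.
by move=> /andP[/eqP -> /andP[/eqP -> _]].
Qed.

End Adjoint.

Section Psd.
Variable (R : realType).
Local Notation C := R[i].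

Lemma psd_gram m n (L : 'M[C]_(m, n)) : psdmx (L ^t* *m L).
Proof.
split=> [|x]; first by rewrite ctM trmxCK.
by rewrite mulmxA -ctM -mulmxA sqnorm_ge0.
Qed.

Lemma psdD n (M N : 'M[C]_n) : psdmx M -> psdmx N -> psdmx (M + N).
Proof.
move=> [hM pM] [hN pN]; split=> [|x]; first by rewrite ctD -hM -hN.
by rewrite mulmxDr mulmxDl mxE addr_ge0.
Qed.

(** By the spectral theorem M = P^* diag(d) P with P unitary. Each d_j is a value of the quadratic
    form, hence nonnegative, and L = diag(sqrt d) P. *)
Lemma psd_factor n (M : 'M[C]_n) :
  psdmx M -> exists L : 'M[C]_n, M = L ^t* *m L.
Proof.
move=> [hM pM].
have nM : M \is normalmx by apply/normalmxP; rewrite -hM.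
have hS := orthomx_spectralP nM.
set P := spectralmx M in hS; set d := spectral_diag M in hS.
have uP : P \is unitarymx by apply: spectral_unitarymx.
rewrite invmx_unitary // in hS.
have PP : P *m P ^t* = 1%:M by apply/unitarymxP.
have hD : P *m M *m P ^t* = diag_mx d.
  by rewrite {1}hS !mulmxA PP mul1mx -mulmxA PP mulmx1.
have hd j : 0 <= d 0 j.
  pose v : 'cV[C]_n := delta_mx j 0.
  have := pM (P ^t* *m v).
  have -> : (P ^t* *m v) ^t* *m M *m (P ^t* *m v) = v ^t* *m diag_mx d *m v.
    by rewrite -hD ctM trmxCK !mulmxA.
  have -> : v ^t* = delta_mx 0 j.
    by apply/matrixP => a b; rewrite !mxE conjC_nat andbC.
  by rewrite -rowE -colE !mxE eqxx.
exists (diag_mx (map_mx sqrtC d) *m P).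
rewrite ctM mulmxA {1}hS -!mulmxA; congr (_ *m _).
rewrite mulmxA; congr (_ *m _).
rewrite tr_diag_mx map_diag_mx mulmx_diag; congr diag_mx.
apply/rowP => j; rewrite !mxE.
have /geC0_conj hs : 0 <= sqrtC (d 0 j) by rewrite sqrtC_ge0.
by rewrite [X in _ = X * _]hs -expr2 sqrtCK.
Qed.

Lemma psd_quad_eq0 n (M : 'M[C]_n) (x : 'cV_n) :
  psdmx M -> x ^t* *m M *m x = 0 -> M *m x = 0.
Proof.
move=> /psd_factor[L ->]; rewrite mulmxA -mulmxA -ctM => /sqnorm_eq0 h.
by rewrite -mulmxA h mulmx0.
Qed.

(* With E = L^* L, L0 is L followed by the orthogonal projection onto the
   column space of L T, in an orthonormal basis of that space. *)
Lemma psd_compress n k (E : 'M[C]_n) (T : 'M_(n, k)) :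
  psdmx E -> exists L0 : 'M_(\rank (E *m T), n), L0 ^t* *m L0 *m T = E *m T.
Proof.
move=> /psd_factor[L ->].
have hr : \rank ((L *m T) ^t*) = \rank (L ^t* *m L *m T).
  by rewrite rank_ct rank_gram_mul.
have [U UU hU] := exists_unitarymx_eqmx ((L *m T) ^t*).
have hUL : U ^t* *m (U *m (L *m T)) = L *m T.
  have hY : ((L *m T) ^t* <= U)%MS by rewrite hU.
  by have := unitary_projK UU hY; rewrite (trmxCK (L *m T)).
rewrite -hr; exists (U *m L).
by rewrite (ctM U L) -!mulmxA hUL.
Qed.

End Psd.

(** * Null space bases and the rank conditions *)

Section NullBases.
Variable (R : realType).
Local Notation C := R[i].

Lemma left_null_eqmx p q k (M : 'M[C]_(p, q)) (T : 'M_(p, k)) :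
  left_null_basis M T -> (T ^t* :=: kermx M)%MS.
Proof.
move=> [_ hT]; apply/eqmxP/andP; split; apply/row_subP => j.
  apply/sub_kermxP; have -> : row j (T ^t*) = (col j T) ^t*.
    by rewrite tr_col map_row.
  by apply/hT; exists (delta_mx j 0); rewrite colE.
set u := row j _.
have /hT[y hy] : (u ^t*) ^t* *m M = 0.
  by rewrite trmxCK /u -row_mul mulmx_ker row0.
by rewrite -[u]trmxCK hy ctM submxMl.
Qed.

Lemma right_null_eqmx p q k (M : 'M[C]_(p, q)) (S : 'M_(q, k)) :
  right_null_basis M S -> (S ^t* :=: kermx (M ^t*))%MS.
Proof.
move=> [rS hS]; apply: left_null_eqmx; split=> // x; rewrite -hS -ctM.
by split=> [/ct_eq0|->]; rewrite ?ct0.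
Qed.

Lemma left_null_mul p q k (M : 'M[C]_(p, q)) (T : 'M_(p, k)) :
  left_null_basis M T -> T ^t* *m M = 0.
Proof. by move=> /left_null_eqmx hT; apply/sub_kermxP; rewrite hT. Qed.

Lemma right_null_mul p q k (M : 'M[C]_(p, q)) (S : 'M_(q, k)) :
  right_null_basis M S -> M *m S = 0.
Proof.
move=> /right_null_eqmx hS; apply: ct_eq0; rewrite ctM.
by apply/sub_kermxP; rewrite hS.
Qed.

(** Double annihilator: whatever is killed by the left nullspace of M lies in the range of M. *)
Lemma left_null_range p q k l (M : 'M[C]_(p, q)) (T : 'M_(p, k))
    (Y : 'M_(p, l)) :
  left_null_basis M T -> T ^t* *m Y = 0 -> exists Z, Y = M *m Z.
Proof.
move=> /left_null_eqmx hT hY.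
have /submxP[Z hZ] : (Y^T <= M^T)%MS.
  apply: submx_kerP => y hy.
  have : (y^T <= T ^t*)%MS.
    rewrite hT; apply/sub_kermxP; apply: trmx_inj.
    by rewrite trmx_mul trmxK hy trmx0.
  case/submxP=> w hw; apply: trmx_inj.
  by rewrite trmx_mul trmxK hw -mulmxA hY mulmx0 trmx0.
by exists Z^T; apply: trmx_inj; rewrite trmx_mul trmxK.
Qed.

Lemma rank_right_null p q k (M : 'M[C]_(p, q)) (S : 'M_(q, k)) :
  right_null_basis M S -> k = (q - \rank M)%N.
Proof.
by move=> hS; rewrite -hS.1 -rank_ct (right_null_eqmx hS) mxrank_ker rank_ct.
Qed.

Lemma rank_left_null_mul p q k l (M : 'M[C]_(p, q)) (T : 'M_(p, k))
    (X : 'M_(p, l)) :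
  left_null_basis M T ->
  (\rank (T ^t* *m X) + \rank (kermx M :&: kermx X)%MS = p - \rank M)%N.
Proof.
move=> hT; rewrite -(mxrank_ker M) -(left_null_eqmx hT) -(mxrank_mul_ker _ X).
congr (_ + _)%N; apply/eqmx_rank/eqmxP/cap_eqmx => //.
exact/eqmx_sym/left_null_eqmx.
Qed.

(** Rank-nullity on the left nullspace of M, where the kernel of X is the left kernel of [X M]. For
    M = B and X = E it identifies the right-hand side of (b) as the rank of T_B^* E. *)
Lemma rank_left_null_row_mx p q k l (M : 'M[C]_(p, q)) (T : 'M_(p, k))
    (X : 'M_(p, l)) :
  left_null_basis M T ->
  (\rank (T ^t* *m X) + \rank M = \rank (row_mx X M))%N.
Proof.
move=> hT; have := rank_left_null_mul X hT.
have -> : \rank (kermx M :&: kermx X)%MS = \rank (kermx (row_mx X M)).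
  apply/eqmx_rank/andP; split.
    apply/sub_kermxP; rewrite mul_mx_row.
    have /sub_kermxP -> := capmxSr (kermx M) (kermx X).
    have /sub_kermxP -> := capmxSl (kermx M) (kermx X).
    by rewrite row_mx0.
  have := mulmx_ker (row_mx X M).
  rewrite mul_mx_row -row_mx0 => /eq_row_mx[h1 h2].
  by rewrite sub_capmx; apply/andP; split; apply/sub_kermxP.
rewrite mxrank_ker; have := rank_leq_row (row_mx X M); have := rank_leq_row M.
have : (\rank M <= \rank (row_mx X M))%N.
  have h : row_mx X M *m col_mx 0 1%:M = M.
    by rewrite mul_row_col mulmx0 add0r mulmx1.
  by have := mxrankM_maxl (row_mx X M) (col_mx 0 1%:M); rewrite h.
lia.
Qed.

(* In coordinates with B = [I; 0] and E = diag(E11, I, 0), the hypotheses on u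
   say that u = [0 0 u3] and that u3 annihilates A31 and A33. *)
Definition regularizable (n m k : nat) (E A : 'M[C]_n) (B : 'M_(n, m))
    (TB : 'M_(n, k)) : Prop :=
  forall u : 'rV[C]_n,
    u *m row_mx E B = 0 -> (u *m A <= TB ^t* *m E)%MS -> u = 0.

(** The left kernel of S is the row space of [TEB ^t* *m A], so the second rank equality says that
    this space meets the row space of [TB ^t* *m E] only in 0. This forces u A = 0, and then (a)
    forces u = 0. *)
Lemma regularizableP (n m : nat) (E A : 'M[C]_n) (B : 'M_(n, m))
    (kB : nat) (TB : 'M_(n, kB)) (kEB : nat) (TEB : 'M_(n, kEB))
    (kS : nat) (S : 'M_(n, kS)) :
  left_null_basis B TB -> left_null_basis (row_mx E B) TEB ->
  right_null_basis (TEB ^t* *m A) S ->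
  regularizable E A B TB <->
  \rank (row_mx E (row_mx A B)) = n /\
  \rank (TB ^t* *m E *m S) = \rank (TB ^t* *m E).
Proof.
move=> hTB hTEB hS.
have hTE := left_null_eqmx hTEB.
have kerS : (kermx S :=: TEB ^t* *m A)%MS.
  apply/eqmx_sym/eqmxP; rewrite -(geq_leqif (mxrank_leqif_eq _)).
    rewrite mxrank_ker -(rank_ct S) (right_null_eqmx hS) mxrank_ker rank_ct.
    by rewrite subKn // rank_leq_col.
  by apply/sub_kermxP; exact: right_null_mul hS.
have := mxrank_mul_ker (TB ^t* *m E) S; set P := TB ^t* *m E => hP.
have capE : (\rank (P *m S) = \rank P) <-> (P :&: TEB ^t* *m A = 0)%MS.
  have hc : \rank (P :&: kermx S)%MS = \rank (P :&: TEB ^t* *m A)%MS.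
    exact/eqmx_rank/eqmxP/cap_eqmx.
  rewrite hc in hP; rewrite -hP; split=> [h|->]; last by rewrite mxrank0 addn0.
  apply/eqP; rewrite -mxrank_eq0; move: h => /eqP.
  by rewrite -{1}[\rank (P *m S)]addn0 eqn_add2l eq_sym.
rewrite capE rank_eq_dim; split=> [h|[ha hb] u hu hA].
  split=> [u|].
    rewrite !mul_mx_row -row_mx0 => /eq_row_mx[h1].
    rewrite -row_mx0 => /eq_row_mx[h2 h3]; apply: h.
      by rewrite mul_mx_row h1 h3 row_mx0.
    by rewrite h2 sub0mx.
  apply/eqP/rowV0P => u; rewrite sub_capmx => /andP[hu /submxP[w hw]].
  have w0 : w *m TEB ^t* = 0.
    apply: h; last by rewrite -mulmxA -hw.
    by rewrite -mulmxA (left_null_mul hTEB) mulmx0.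
  by rewrite hw mulmxA w0 mul0mx.
have : (u <= TEB ^t*)%MS by rewrite hTE; apply/sub_kermxP.
case/submxP=> w hw.
have uA : u *m A = 0.
  apply/eqP; rewrite -submx0 -hb sub_capmx hA /=.
  by rewrite hw -mulmxA submxMl.
apply: ha; move: hu; rewrite !mul_mx_row uA -[X in _ = X -> _]row_mx0.
by move=> /eq_row_mx[-> ->]; rewrite !row_mx0.
Qed.

End NullBases.

(** * Jordan form *)

Lemma exists_rank_stable (F : fieldType) (n : nat) (N : 'M[F]_n) :
  exists k, (\rank (N ^+ k) <= \rank (N ^+ k.+1))%N.
Proof.
case: (boolP [exists k : 'I_n.+1, (\rank (N ^+ k) <= \rank (N ^+ k.+1))%N]).
  by case/existsP=> k hk; exists k.
rewrite negb_exists => /forallP h.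
have hr k : (k <= n.+1)%N -> (\rank (N ^+ k) + k <= n)%N.
  elim: k => [|k IH] hk; first by rewrite addn0 rank_leq_row.
  have := h (Ordinal hk); rewrite -ltnNge /= => hlt.
  by rewrite addnS (leq_trans _ (IH (ltnW hk))) // ltn_add2r.
by have := hr n.+1 (leqnn _); rewrite addnS ltnNge leq_addl.
Qed.

(** Here p + 1 is the least exponent at which the ranks of the powers stabilize. If the pairing
    through N^p of the left and right kernels of N^(p+1) vanished, the left kernel of N^(p+1) would
    already be that of N^p, against minimality. *)
Lemma singular_height (F : fieldType) (n : nat) (N : 'M[F]_n) :
  N \notin unitmx ->
  exists (p : nat) (v : 'rV[F]_n) (f : 'cV[F]_n),
    [/\ v *m N ^+ p.+1 = 0, N ^+ p.+1 *m f = 0 & v *m N ^+ p *m f != 0].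
Proof.
move=> hN.
case: (ex_minnP (exists_rank_stable N)) => [[|p]] hp hmin.
  case/negP: hN; rewrite -row_free_unit /row_free eqn_leq rank_leq_row /=.
  by move: hp; rewrite expr0 expr1 mxrank1.
have hlt : (\rank (N ^+ p.+1) < \rank (N ^+ p))%N.
  by rewrite ltnNge; apply/negP => /hmin; rewrite ltnn.
set Kr := kermx (N ^+ p.+1); set Kc := cokermx (N ^+ p.+1).
have hK : Kr *m N ^+ p *m Kc != 0.
  apply/eqP => h0.
  have /submxP[U hU] : (Kr *m N ^+ p <= N ^+ p.+1)%MS by rewrite submxE h0.
  have hU1 : U *m N ^+ p.+2 = 0.
    rewrite exprSr -[_ * _]/(_ *m _) mulmxA -hU -mulmxA.
    by rewrite -[_ *m N]exprSr mulmx_ker.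
  have hkk : (kermx (N ^+ p.+1) == kermx (N ^+ p.+2))%MS.
    rewrite -(geq_leqif (mxrank_leqif_eq _)); last first.
      apply/sub_kermxP; rewrite [in X in _ *m X]exprSr -[_ * _]/(_ *m _).
      by rewrite mulmxA mulmx_ker mul0mx.
    by rewrite !mxrank_ker leq_sub2l.
  have hU2 : U *m N ^+ p.+1 = 0.
    by apply/sub_kermxP; rewrite (eqmxP hkk); apply/sub_kermxP.
  have : (Kr <= kermx (N ^+ p))%MS by apply/sub_kermxP; rewrite hU.
  move/mxrankS; rewrite !mxrank_ker leq_sub2lE ?rank_leq_row //.
  by rewrite leqNgt hlt.
have [i [j hij]] : exists i j, (Kr *m N ^+ p *m Kc) i j != 0.
  by case/matrix0Pn: hK => i [j hij]; exists i, j.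
exists p, (row i Kr), (col j Kc); split.
- by rewrite -row_mul mulmx_ker row0.
- by rewrite colE mulmxA mulmx_coker mul0mx.
apply: contraNneq hij => h.
suff -> : (Kr *m N ^+ p *m Kc) i j = (row i Kr *m N ^+ p *m col j Kc) 0 0.
  by rewrite h mxE.
by rewrite -!row_mul colE mulmxA -colE !mxE.
Qed.

(** The rows form a Jordan chain: v N^i A = a v N^i + v N^(i+1), and the last shift vanishes because
    v N^p = 0. *)
Lemma jordan_cyclic (R : realType) (n p : nat) (a : R[i]) (A : 'M[R[i]]_n)
    (v : 'rV[R[i]]_n) :
  let N := A - a%:M in
  v *m N ^+ p = 0 ->
  let V := \matrix_(i < p) (v *m N ^+ i) in
  V *m A = jordan_block a p *m V.
Proof.
move=> N hv V; apply/row_matrixP => i.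
have -> : A = a%:M + N by rewrite /N addrC subrK.
rewrite mulmxDr mul_mx_scalar linearD linearZ /= row_mul rowK.
rewrite row_mul.
rewrite [RHS]mulmx_sum_row (bigD1 i) //= !mxE eqxx rowK; congr (_ + _).
rewrite -mulmxA -[_ *m N]exprSr.
have [hi|hi] := ltnP i.+1 p.
  have hne : (Ordinal hi == i) = false.
    by rewrite -val_eqE; apply: gtn_eqF; apply: ltnSn.
  rewrite (bigD1 (Ordinal hi)) ?hne //= !mxE eq_sym hne eqxx scale1r rowK.
  rewrite big1 ?addr0 //.
  move=> j /andP[hj1 hj2]; rewrite !mxE eq_sym (negbTE hj1).
  have -> : (i.+1 == j :> nat) = false.
    by apply/negbTE; apply: contraNneq hj2 => h; apply/eqP/val_inj.
  by rewrite scale0r.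
have -> : i.+1 = p by apply/eqP; rewrite eqn_leq hi ltn_ord.
rewrite hv big1 // => j hj; rewrite !mxE eq_sym (negbTE hj).
have -> : (i.+1 == j :> nat) = false.
  by apply/negbTE; rewrite neq_ltn (leq_trans (ltn_ord j) hi) orbT.
by rewrite scale0r.
Qed.

(* For N = A - a nilpotent of height p on the generalized eigenspace of a,
   choose v and f with v N^(p-1) f != 0, v N^p = 0 and N^p f = 0.  The Gram matrix
   (v N^i N^(p-1-j) f) is triangular and invertible, so the rows v N^i span a
   complement of the invariant subspace {x | x N^j f = 0 for all j}. *)
Lemma jordan_split (R : realType) (n : nat) (A : 'M[R[i]]_n) :
  (0 < n)%N ->
  exists (a : R[i]) (p k : nat) (Q : 'M[R[i]]_(p + k, n)) (A' : 'M[R[i]]_k),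
    [/\ (0 < p)%N, (p + k = n)%N, row_free Q &
        Q *m A = block_mx (jordan_block a p) 0 0 A' *m Q].
Proof.
move=> n_gt0; have [a ha] := eigenvalue_closed A n_gt0.
pose N := A - a%:M.
have hN : N \notin unitmx.
  rewrite -row_free_unit -kermx_eq0; exact: ha.
have [p [v [f [hv hf hvf]]]] := singular_height hN.
pose V : 'M_(p.+1, n) := \matrix_(i < p.+1) (v *m N ^+ i).
pose W : 'M_(n, p.+1) := \matrix_(i, j) (N ^+ (p - j) *m f) i 0.
have colW j : col j W = N ^+ (p - j) *m f.
  by apply/colP => i; rewrite !mxE.
have hG i j : (V *m W) i j = (v *m N ^+ (i + (p - j)) *m f) 0 0.
  have -> : (V *m W) i j = (row i V *m col j W) 0 0.
    by rewrite -row_mul colE mulmxA -colE !mxE.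
  by rewrite rowK colW mulmxA -(mulmxA v) exprD.
have uG : V *m W \in unitmx.
  rewrite unitmxE unitfE -det_tr det_trig; last first.
    apply/is_trig_mxP => i j hij; rewrite mxE hG.
    have -> : (j + (p - i) = p.+1 + (j - i.+1))%N.
      by have := ltn_ord i; lia.
    by rewrite exprD mulmxA hv !mul0mx mxE.
  apply/prodf_neq0 => i _; rewrite mxE hG.
  have hi := ltn_ord i; rewrite ltnS in hi; rewrite subnKC //.
  by apply: contraNneq hvf => h; apply/eqP/matrixP => x y; rewrite !ord1 h mxE.
(* The left kernel of W is invariant under N: multiplication by N moves column j of W to column j -
   1, and column 0 to N^(p+1) f = 0. *)
have NW (x : 'rV_n) : x *m W = 0 -> x *m N *m W = 0.
  move=> hx; apply/rowP => j.
  have -> : (x *m N *m W) 0 j = (x *m N *m col j W) 0 0.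
    by rewrite colE mulmxA -colE !mxE.
  rewrite colW mulmxA -(mulmxA x) -[N *m _]exprS.
  case hj : (j : nat) => [|j']; first by rewrite subn0 -mulmxA hf mulmx0 !mxE.
  have hj' : (j' < p.+1)%N by rewrite -ltnS -hj (leq_trans (ltn_ord j)).
  have hjp : (j' < p)%N by have := ltn_ord j; rewrite hj ltnS.
  rewrite subnSK // -mulmxA -(colW (Ordinal hj')) colE mulmxA hx mul0mx.
  by rewrite !mxE.
have [K [fK KW KE]] : exists K : 'M_(\rank (kermx W), n),
    [/\ row_free K, K *m W = 0 &
        forall k (X : 'M_(k, n)), X *m W = 0 -> (X <= K)%MS].
  exists (row_base (kermx W)); split; first exact: row_base_free.
    by apply/sub_kermxP; rewrite eq_row_base.
  by move=> k X hX; rewrite eq_row_base; apply/sub_kermxP.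
have rW : \rank W = p.+1.
  apply/eqP; rewrite eqn_leq rank_leq_col /=.
  by rewrite -[X in (X <= _)%N](mxrank_unit uG) mxrankM_maxr.
have hp : (p.+1 <= n)%N by rewrite -rW rank_leq_row.
have /submxP[A' hA'] : (K *m N <= K)%MS.
  apply: KE; apply/row_matrixP => i.
  by rewrite row0 !row_mul NW // -row_mul KW row0.
exists a, p.+1, (\rank (kermx W)), (col_mx V K), (A' + a%:M); split => //.
- by rewrite mxrank_ker rW subnKC.
- rewrite -kermx_eq0; apply/rowV0P => x /sub_kermxP.
  rewrite -[x]hsubmxK mul_row_col => hx.
  have hl : lsubmx x = 0.
    have := congr1 (mulmx^~ W) hx.
    rewrite /= mulmxDl -!mulmxA KW mulmx0 addr0 mul0mx.
    by move/(congr1 (mulmx^~ (invmx (V *m W)))); rewrite /= mulmxK // mul0mx.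
  move: hx; rewrite hl mul0mx add0r => hx.
  have -> : rsubmx x = 0.
    by apply: (row_free_inj fK); rewrite hx mul0mx.
  by rewrite row_mx0.
rewrite mul_col_mx mul_block_col !mul0mx addr0 add0r (jordan_cyclic hv).
congr (col_mx _ _); rewrite mulmxDl mul_scalar_mx -hA' /N mulmxBr mul_mx_scalar.
by rewrite subrK.
Qed.

(** Induction on n, splitting off one block at a time. Blocks are kept in a list so that a new one
    is a cons, and Q is rectangular and row free to postpone identifying its height with n. *)
Theorem jordan_form (R : realType) (n : nat) (A : 'M[R[i]]_n) :
  exists (s : seq (R[i] * nat))
    (Q : 'M_(\sum_(i < size s) (nth (0%R, 0%N) s i).2, n)),
    [/\ forall i : 'I_(size s), (0 < (nth (0%R, 0%N) s i).2)%N,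
        (\sum_(i < size s) (nth (0%R, 0%N) s i).2 = n)%N, row_free Q &
        Q *m A = (\mxdiag_(i < size s) jordan_block (nth (0%R, 0%N) s i).1
                    (nth (0%R, 0%N) s i).2) *m Q].
Proof.
elim/ltn_ind: n A => n IH A.
case: (posnP n) => [n0|n_gt0].
  subst n; exists [::], 0; split; [by case| by rewrite big_ord0| |].
    by rewrite /row_free mxrank0 big_ord0.
  by rewrite mulmx0 mul0mx.
have [a [p [k [Q [A' [p_gt0 hpk fQ hQ]]]]]] := jordan_split A n_gt0.
have [|s [Q' [s_gt0 hs fQ' hQ']]] := IH k _ A'.
  by rewrite -hpk -[X in (X < _)%N]add0n ltn_add2r.
pose s' := (a, p) :: s.
pose e := @mxsize_recl (size s) (fun i => (nth (0%R : R[i], 0%N) s' i).2).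
exists s', (castmx (e, erefl) (block_mx 1%:M 0 0 Q' *m Q)); split.
- by case=> -[|i] hi //; exact: (s_gt0 (Ordinal (hi : (i < size s)%N))).
- by rewrite -e /= hs.
- have castF : forall a1 a2 (h : a1 = a2) (X : 'M[R[i]]_(a1, n)),
      row_free (castmx (h, erefl) X) = row_free X.
    by move=> a1 a2 h; case: a2 / h => X; rewrite castmx_id.
  rewrite castF /row_free mxrankMfree // rank_diag_block_mx mxrank1.
  by rewrite (eqP fQ').
rewrite mxdiag_recl /=.
have castM : forall a1 a2 (h : a1 = a2) (X : 'M[R[i]]_a1)
      (Y : 'M[R[i]]_(a1, n)),
    castmx (h, h) X *m castmx (h, erefl) Y = castmx (h, erefl) (X *m Y).
  by move=> a1 a2 h; case: a2 / h => X Y; rewrite !castmx_id.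
have castMr : forall a1 a2 (h : a1 = a2) (X : 'M[R[i]]_n)
      (Y : 'M[R[i]]_(a1, n)),
    castmx (h, erefl) Y *m X = castmx (h, erefl) (Y *m X).
  by move=> a1 a2 h; case: a2 / h => X Y; rewrite !castmx_id.
rewrite [LHS]castMr [RHS]castM -mulmxA hQ !mulmxA; congr (castmx _ (_ *m _)).
by rewrite !mulmx_block !(mulmx0, mul0mx, mul1mx, mulmx1, addr0, add0r) hQ'.
Qed.

(** * Pencils of index at most one *)

(** All blocks at infinity have size 1, so the nilpotent part is 0. In Weierstrass coordinates E x =
    0 kills the finite part of x, and A x in the range of E kills the infinite part. *)
Lemma index_le1_kernel (R : realType) (n : nat) (E A : 'M[R[i]]_n) (nu : nat)
    (x z : 'cV[R[i]]_n) :
  pencil_index E A nu -> (nu <= 1)%N ->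
  E *m x = 0 -> A *m x = E *m z -> x = 0.
Proof.
move=> [k [p [a [l [q [[p_gt0 q_gt0 [e [P [Q [uP uQ hE hA]]]]] hnu]]]]]] hle.
have N0 : \mxdiag_j jordan_block (0 : R[i]) (q j) = 0.
  rewrite -[RHS]mxdiag0; apply: eq_mxdiag => j.
  have hq : (q j <= 1)%N by apply: leq_trans hle; rewrite hnu leq_bigmax.
  apply/matrixP => s t; rewrite !mxE; case: eqP => // _.
  by have := ltn_ord s; have := ltn_ord t; case: eqP => //; lia.
rewrite {}N0 in hE; subst n; rewrite !castmx_id in hE hA.
rewrite {}hE {}hA -!mulmxA; set y := Q *m x; set w := Q *m z.
move/(congr1 (mulmx (invmx P))); rewrite mulKmx // mulmx0 => h1.
move/(congr1 (mulmx (invmx P))); rewrite !mulKmx // => h2.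
have y0 : y = 0.
  move: h1 h2; rewrite -[y]vsubmxK -[w]vsubmxK !mul_block_col.
  rewrite !(mul1mx, mul0mx, addr0, add0r) => h1 /eq_col_mx[_ ->].
  by have /eq_col_mx[->] := etrans h1 (esym (col_mx0 _ _ _ _)); rewrite col_mx0.
by rewrite -[x](mulKmx uQ) -/y y0 mulmx0.
Qed.

(** The corank is written as a sum of ones to match [weierstrass_form] with every block at infinity
    of size 1. *)
Lemma rank_normal_form (F : fieldType) (n : nat) (E : 'M[F]_n) :
  exists (r l : nat) (e : (r + \sum_(j < l) 1 = n)%N) (P Q : 'M[F]_n),
    [/\ P \in unitmx, Q \in unitmx &
        E = P *m castmx (e, e) (block_mx 1%:M 0 0 0) *m Q].
Proof.
have e : (\rank E + \sum_(j < n - \rank E) 1 = n)%N.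
  by rewrite sum1_card card_ord subnKC // rank_leq_row.
exists (\rank E), (n - \rank E)%N, e, (col_ebase E), (row_ebase E).
rewrite col_ebase_unit row_ebase_unit; split => //.
have cast_pid r k (h : (r + k = n)%N) :
    castmx (h, h) (block_mx 1%:M 0 0 0) = pid_mx r :> 'M[F]_n.
  by move: E e; subst n => *; rewrite castmx_id pid_mx_block.
by rewrite cast_pid mulmx_ebase.
Qed.

Lemma unit_ublock (F : fieldType) (m n : nat) (A : 'M[F]_m) (B : 'M_(m, n))
    (D : 'M_n) :
  A \in unitmx -> D \in unitmx -> block_mx A B 0 D \in unitmx.
Proof. by rewrite !unitmxE det_ublock unitrM => -> ->. Qed.

Lemma unit_lblock (F : fieldType) (m n : nat) (A : 'M[F]_m) (C : 'M_(n, m))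
    (D : 'M_n) :
  A \in unitmx -> D \in unitmx -> block_mx A 0 C D \in unitmx.
Proof. by rewrite !unitmxE det_lblock unitrM => -> ->. Qed.

Lemma unitmx_kerP (F : fieldType) (n : nat) (A : 'M[F]_n) :
  (forall x : 'cV_n, A *m x = 0 -> x = 0) -> A \in unitmx.
Proof.
move=> h; rewrite -unitmx_tr -row_free_unit -kermx_eq0.
apply/rowV0P => x /sub_kermxP hx.
apply: trmx_inj; rewrite trmx0; apply: h.
by apply: trmx_inj; rewrite trmx_mul trmxK trmx0.
Qed.

(** Block elimination with pivot A22 preserves diag(I, 0) and leaves the Schur complement, which T
    conjugates to J. *)
Lemma schur_pencil (F : fieldType) (k l : nat) (T J A11 : 'M[F]_k)
    (A12 : 'M_(k, l)) (A21 : 'M_(l, k)) (A22 : 'M_l) :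
  T \in unitmx -> A22 \in unitmx ->
  A11 = invmx T *m J *m T + A12 *m invmx A22 *m A21 ->
  let P := block_mx 1%:M A12 0 A22 *m block_mx (invmx T) 0 0 1%:M in
  let Q := block_mx T 0 0 1%:M *m block_mx 1%:M 0 (invmx A22 *m A21) 1%:M in
  [/\ P \in unitmx, Q \in unitmx,
      block_mx 1%:M 0 0 0 = P *m block_mx 1%:M 0 0 0 *m Q &
      block_mx A11 A12 A21 A22 = P *m block_mx J 0 0 1%:M *m Q].
Proof.
move=> uT uA22 -> P Q; split.
- by rewrite unitmx_mul !unit_ublock ?unitmx1 ?unitmx_inv.
- by rewrite unitmx_mul !unit_lblock ?unitmx1.
- rewrite /P /Q !mulmx_block !(mulmx0, mul0mx, mul1mx, mulmx1, addr0, add0r).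
  by rewrite mulVmx.
rewrite /P /Q !mulmx_block !(mulmx0, mul0mx, mul1mx, mulmx1, addr0, add0r).
by rewrite !mulmxA mulmxV // mul1mx.
Qed.

Lemma index_le1_intro (R : realType) (n : nat) (E A : 'M[R[i]]_n) :
  (forall x z : 'cV[R[i]]_n, E *m x = 0 -> A *m x = E *m z -> x = 0) ->
  exists2 nu : nat, pencil_index E A nu & (nu <= 1)%N.
Proof.
move=> h.
have [r [l [e [P [Q [uP uQ hE]]]]]] := rank_normal_form E.
subst n; rewrite castmx_id in hE.
have [A0 hA] : exists A0, A = P *m A0 *m Q.
  by exists (invmx P *m A *m invmx Q); rewrite !mulmxA mulmxV // mul1mx mulmxKV.
set A11 := ulsubmx A0; set A12 := ursubmx A0.
set A21 := dlsubmx A0; set A22 := drsubmx A0.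
have hA0 : A0 = block_mx A11 A12 A21 A22 by rewrite submxK.
have uA22 : A22 \in unitmx.
  apply: unitmx_kerP => x hx.
  suff : invmx Q *m (col_mx 0 x : 'cV_(_ + _)) = 0.
    move/(congr1 (mulmx Q)); rewrite mulKVmx // mulmx0.
    by rewrite -[RHS]col_mx0 => /eq_col_mx[].
  (* When A22 x = 0, A0 maps (0, x) to (A12 x, 0), which diag(I, 0) fixes; this supplies z. *)
  apply: (h _ (invmx Q *m (col_mx (A12 *m x) 0 : 'cV_(_ + _)))).
    rewrite hE -!mulmxA mulKVmx // mul_block_col.
    by rewrite !(mulmx0, mul0mx, addr0) col_mx0 mulmx0.
  rewrite hE hA -!mulmxA !mulKVmx // hA0 !mul_block_col hx.
  by rewrite !(mulmx0, mul0mx, mul1mx, addr0, add0r).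
have [s [T [p_gt0 hs fT hT]]] := jordan_form (A11 - A12 *m invmx A22 *m A21).
subst r.
have uT : T \in unitmx by rewrite -row_free_unit.
have hS : A11 = invmx T *m \mxdiag_(i < size s)
      jordan_block (nth (0%R, 0%N) s i).1 (nth (0%R, 0%N) s i).2 *m T
      + A12 *m invmx A22 *m A21.
  by rewrite -mulmxA -hT mulKmx // subrK.
exists (\max_(j < l) 1)%N; last by apply/bigmax_leqP.
exists (size s), (fun i => (nth (0%R, 0%N) s i).2).
exists (fun i => (nth (0%R, 0%N) s i).1), l, (fun=> 1%N).
split => //; split => //.
exists erefl.
have [uP' uQ' hE' hA'] := schur_pencil uT uA22 hS.
move: {hT hS} (_ *m block_mx (invmx T) _ _ _) (block_mx T _ _ _ *m _)
  uP' uQ' hE' hA' => P' Q' uP' uQ' hE' hA'; exists (P *m P'), (Q' *m Q).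
have N0 : \mxdiag_(j < l) jordan_block (0 : R[i]) 1 = 0.
  rewrite -[RHS]mxdiag0; apply: eq_mxdiag => j.
  by apply/matrixP => u v; rewrite !ord1 !mxE eqxx.
have mul5 p (P1 P2 D Q2 Q1 : 'M[R[i]]_p) :
    P1 *m (P2 *m D *m Q2) *m Q1 = P1 *m P2 *m D *m (Q2 *m Q1).
  by rewrite !mulmxA.
rewrite N0 !castmx_id !unitmx_mul uP uP' uQ uQ'; split => //.
  by rewrite hE [in LHS]hE' mul5.
by rewrite hA hA0 hA' mul5.
Qed.

(** * Stabilizing feedback *)

Section Dissipative.
Variable (R : realType).
Local Notation C := R[i].

Lemma psdD_ker (n : nat) (M N : 'M[C]_n) (x : 'cV_n) :
  psdmx M -> psdmx N -> (M + N) *m x = 0 -> M *m x = 0 /\ N *m x = 0.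
Proof.
move=> hM hN h.
have : (x ^t* *m M *m x) 0 0 + (x ^t* *m N *m x) 0 0 = 0.
  have := congr1 (fun y => (x ^t* *m y) 0 0) h.
  by rewrite /= mulmxDl mulmxDr !mulmxA mulmx0 !mxE.
move/eqP; rewrite paddr_eq0 ?hM.2 ?hN.2 // => /andP[/eqP hM0 /eqP hN0].
by split; apply: psd_quad_eq0 => //; apply: mx11_eq0.
Qed.

(** x^* J x is skew and x^* R x Hermitian, so their equality makes both zero. Then R x = 0 and only
    J acts on x, which lets left and right vectors be exchanged. *)
Lemma dissipative_null (n : nat) (J Rd : 'M[C]_n) (x : 'cV_n) :
  J = - J ^t* -> psdmx Rd -> x ^t* *m (J - Rd) *m x = 0 ->
  Rd *m x = 0 /\ x ^t* *m (J - Rd) = - ((J - Rd) *m x) ^t*.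
Proof.
move=> hJ hR h.
have hq : x ^t* *m J *m x = x ^t* *m Rd *m x.
  by apply/eqP; rewrite -subr_eq0 -mulmxBl -mulmxBr h.
have Rx0 : Rd *m x = 0.
  apply: psd_quad_eq0 => //.
  have hqt : (x ^t* *m Rd *m x) ^t* = x ^t* *m Rd *m x.
    by rewrite !ctM trmxCK -hR.1 mulmxA.
  have hjt : (x ^t* *m J *m x) ^t* = - (x ^t* *m J *m x).
    by rewrite !ctM trmxCK {2}hJ mulmxN mulNmx opprK mulmxA.
  move: hjt; rewrite hq hqt => /eqP; rewrite -addr_eq0 -mulr2n -scaler_nat.
  by rewrite scaler_eq0 pnatr_eq0 /= => /eqP.
split=> //; rewrite mulmxBl Rx0 subr0 mulmxBr ctM.
have -> : x ^t* *m Rd = 0 by rewrite hR.1 -ctM Rx0 ct0.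
by rewrite subr0 -mulmxN -hJ.
Qed.

Lemma re_ge0 (l : C) : ~~ (complex.Re l < 0) -> 0 <= l + l^*%R.
Proof.
rewrite -leNgt; case: l => a b /= ha.
by rewrite lecE /= addr_ge0 // subrr eqxx.
Qed.

Lemma re_eq0 (l : C) : l + l^*%R = 0 -> complex.Re l = 0.
Proof.
case: l => a b /eqP; rewrite eq_complex /= => /andP[/eqP + _].
by move/eqP; rewrite -mulr2n mulrn_eq0 /= => /eqP.
Qed.

Lemma dissipative_pencil_null (n : nat) (E J Rd : 'M[C]_n) (l : C) (x : 'cV_n) :
  psdmx E -> J = - J ^t* -> psdmx Rd -> 0 <= l + l^*%R ->
  (l *: E - (J - Rd)) *m x = 0 ->
  (E *m x = 0 /\ (J - Rd) *m x = 0) \/ (l + l^*%R = 0 /\ Rd *m x = 0).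
Proof.
move=> hE hJ hR hl hx.
have hj : (((x ^t* *m J *m x) 0 0)^*)%R = - (x ^t* *m J *m x) 0 0.
  have -> : (((x ^t* *m J *m x) 0 0)^*)%R = (x ^t* *m J *m x) ^t* 0 0.
    by rewrite [in RHS]mxE [in RHS]mxE.
  by rewrite !ctM trmxCK {2}hJ mulmxN mulNmx [in RHS]mxE opprK mulmxA.
have h1 : l * (x ^t* *m E *m x) 0 0 - (x ^t* *m J *m x) 0 0
    + (x ^t* *m Rd *m x) 0 0 = 0.
  have : x ^t* *m (l *: E - (J - Rd)) *m x = 0 by rewrite -mulmxA hx mulmx0.
  rewrite opprB addrA addrAC mulmxDr mulmxBr mulmxDl mulmxBl.
  rewrite -scalemxAr -scalemxAl.
  by move/matrixP/(_ 0 0); rewrite !mxE.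
have [+ q0] := quad_sign (hE.2 x) (hR.2 x) hj hl h1; move/eqP.
have Rx : Rd *m x = 0 by apply: psd_quad_eq0 => //; apply: mx11_eq0.
rewrite mulf_eq0 => /orP[/eqP l0|/eqP e0]; first by right.
left; have Ex : E *m x = 0 by apply: psd_quad_eq0 => //; apply: mx11_eq0.
split=> //; move: hx; rewrite mulmxBl -scalemxAl Ex scaler0 sub0r.
by move/eqP; rewrite oppr_eq0 => /eqP.
Qed.

(** An eigenvector in the closed right half plane is either in the common kernel of E and A,
    excluded by the index hypothesis with z = 0, or has imaginary eigenvalue and R x = 0, excluded
    by the last hypothesis. *)
Lemma dissipative_stable (n : nat) (E J Rd : 'M[C]_n) :
  psdmx E -> J = - J ^t* -> psdmx Rd ->
  (forall x z : 'cV_n, E *m x = 0 -> (J - Rd) *m x = E *m z -> x = 0) ->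
  (forall (s : C) (x : 'cV_n), s^*%R = - s -> Rd *m x = 0 ->
     J *m x = s *: (E *m x) -> x = 0) ->
  [/\ regular_pair E (J - Rd),
      exists2 nu : nat, pencil_index E (J - Rd) nu & (nu <= 1)%N &
      forall l : C, finite_eigenvalue E (J - Rd) l -> complex.Re l < 0].
Proof.
move=> hE hJ hR hind himag.
have hdet (l : C) : ~~ (complex.Re l < 0) -> \det (l *: E - (J - Rd)) != 0.
  move=> hl; rewrite -unitfE -unitmxE; apply: unitmx_kerP => x hx.
  case: (dissipative_pencil_null hE hJ hR (re_ge0 hl) hx) => [[Ex Ax]|[l0 Rx]].
    by apply: (hind x 0) => //; rewrite Ax mulmx0.
  apply: (himag l) => //; first by apply/eqP; rewrite -addr_eq0 addrC l0.
  move: hx; rewrite opprB addrA addrAC mulmxDl mulmxBl Rx addr0 -scalemxAl.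
  by move/eqP; rewrite subr_eq0 => /eqP.
split; first by exists 1; apply: hdet; rewrite -leNgt.
  exact: index_le1_intro.
by move=> l hl; apply: contraT => /hdet; rewrite hl eqxx.
Qed.

(* The Schur complement of E on the range of TB, i.e. the smallest positive
   semidefinite matrix of the form E + B K B^*. *)
Lemma psd_shorted (n m k : nat) (E : 'M[C]_n) (B : 'M_(n, m)) (TB : 'M_(n, k)) :
  psdmx E -> \rank B = m -> left_null_basis B TB ->
  exists (K0 : 'M_m) (L0 : 'M_(\rank (E *m TB), n)),
    [/\ K0 = K0 ^t*, E + B *m K0 *m B ^t* = L0 ^t* *m L0 &
        L0 ^t* *m L0 *m TB = E *m TB].
Proof.
move=> hE rB hTB.
have [L0 hL0] := psd_compress TB hE.
(* H is Hermitian and killed by [TB], so both its columns and its rows come from B; hence H = B K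
   B^*. *)
set H := L0 ^t* *m L0 - E.
have HH : H ^t* = H by rewrite ctD ctN ctM trmxCK -hE.1.
have HT : H *m TB = 0 by rewrite mulmxBl hL0 subrr.
have BT0 : B ^t* *m TB = 0.
  by apply: ct_eq0; rewrite ctM trmxCK; exact: left_null_mul.
have fB : row_free (B ^t*) by rewrite /row_free rank_ct rB.
have injB p (X : 'M_(m, p)) : B *m X = 0 -> X = 0.
  move=> h; apply: ct_eq0; apply: (row_free_inj fB).
  by rewrite -ctM h ct0 mul0mx.
have [Z hZ] : exists Z, H = B *m Z.
  by apply: (left_null_range hTB); rewrite -HH -ctM HT ct0.
have [K0 hK0] : exists K0, Z ^t* = B *m K0.
  apply: (left_null_range hTB); rewrite -ctM.
  by rewrite (injB _ (Z *m TB)) ?ct0 // mulmxA -hZ.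
have hH : H = B *m K0 ^t* *m B ^t* by rewrite hZ -[Z]trmxCK hK0 ctM mulmxA.
exists (K0 ^t*), L0; split=> //; last by rewrite -hH addrC subrK.
rewrite trmxCK; apply: (row_free_inj fB); apply/eqP; rewrite -subr_eq0 -mulmxBl.
apply/eqP/injB; rewrite mulmxA mulmxBr mulmxBl -hH.
by rewrite -[in X in X - _]HH hH !ctM !trmxCK mulmxA subrr.
Qed.

Lemma row_free_col_mx (n g m k : nat) (L : 'M[C]_(g, n)) (N : 'M_(m, n))
    (T : 'M_(n, k)) :
  row_free (L *m T) -> N *m T = 0 -> row_free N -> row_free (col_mx L N).
Proof.
move=> fL hN fN; rewrite -kermx_eq0; apply/rowV0P => u /sub_kermxP.
rewrite -[u]hsubmxK mul_row_col => hu.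
have u1 : lsubmx u = 0.
  apply: (row_free_inj fL); rewrite mul0mx mulmxA.
  have := congr1 (mulmx^~ T) hu.
  by rewrite /= mulmxDl -(mulmxA _ N) hN mulmx0 addr0 mul0mx.
move: hu; rewrite u1 mul0mx add0r => hu.
have -> : rsubmx u = 0 by apply: (row_free_inj fN); rewrite hu mul0mx.
by rewrite row_mx0.
Qed.

(* In the block coordinates above, the rows [0 0 u3] with u3 A33 = 0. *)
Definition null_part (n m k : nat) (E A : 'M[C]_n) (B : 'M_(n, m))
    (S : 'M_(n, k)) : 'M[C]_n :=
  (kermx (A *m S) :&: kermx (row_mx E B))%MS.

(* The subtraction in the bound on rho truncates, so rho = 0 is always allowed.
   In block coordinates K1 = D^* D, where D has rank rho and vanishes on
   A13 (ker A33), the column space of D0^*. *)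
Lemma feedback_exists (n m : nat) (E J Rd : 'M[C]_n) (B : 'M_(n, m))
    (k : nat) (TB : 'M_(n, k)) (k' : nat) (S : 'M_(n, k')) (rho : nat) :
  psdmx E -> psdmx Rd -> J = - J ^t* -> \rank B = m ->
  left_null_basis B TB -> right_null_basis (col_mx E (B ^t*)) S ->
  regularizable E (J - Rd) B TB ->
  (forall s : C, complex.Re s = 0 -> \rank (row_mx (J - Rd - s *: E) B) = n) ->
  (rho <= m - \rank (null_part E (J - Rd) B S))%N ->
  exists K FS FH : 'M_m, stabilizing_feedback E J Rd B K FS FH /\
    \rank (E + B *m K *m B ^t*)%R = (\rank (TB ^t* *m E) + rho)%N.
Proof.
move=> hE hR hJ rB hTB hS hreg hc hrho.
set A := J - Rd in hreg hc hrho *; set Nd := null_part E A B S in hrho.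
have fB : row_free (B ^t*) by rewrite /row_free rank_ct rB.
have BT0 : B ^t* *m TB = 0.
  by apply: ct_eq0; rewrite ctM trmxCK; exact: left_null_mul.
have [K0 [L0 [hK0 hE0 hL0]]] := psd_shorted hE rB hTB.
have fLT : row_free (L0 *m TB) by rewrite /row_free -rank_gram_mul hL0.
have fG : row_free (col_mx L0 (B ^t*)) by exact: row_free_col_mx fLT BT0 fB.
(* In block coordinates Y0 = [I; 0; 0], the directions on which the feedback acts. *)
have [Y0 LY0 BY0] : exists2 Y0 : 'M_(n, m), L0 *m Y0 = 0 & B ^t* *m Y0 = 1%:M.
  have [Gi hGi] := row_freeP fG; exists (Gi *m col_mx 0 1%:M).
  + have := congr1 (mulmx^~ (col_mx 0 1%:M : 'M_(_ + m, m))) hGi.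
    by rewrite /= mul1mx -mulmxA mul_col_mx => /eq_col_mx[->].
  + have := congr1 (mulmx^~ (col_mx 0 1%:M : 'M_(_ + m, m))) hGi.
    by rewrite /= mul1mx -mulmxA mul_col_mx => /eq_col_mx[_ ->].
set D0 := Nd *m A *m Y0.
have [D fD hD] : exists2 D : 'M_(rho, m), row_free D & D *m D0 ^t* = 0.
  have [|D fD hD] := @exists_row_free_sub C rho _ _ (kermx (D0 ^t*)).
    rewrite mxrank_ker rank_ct.
    have hle : (\rank D0 <= \rank Nd)%N by rewrite /D0 -mulmxA mxrankM_maxl.
    exact: leq_trans hrho (leq_sub2l m hle).
  by exists D => //; apply/sub_kermxP.
pose W := col_mx L0 (D *m B ^t*).
have [K hE'] : exists K, E + B *m K *m B ^t* = W ^t* *m W.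
  exists (K0 + D ^t* *m D); rewrite ct_col_mx mul_row_col -hE0 ctM trmxCK.
  rewrite mulmxDr mulmxDl addrA.
  by rewrite !mulmxA.
have fW : row_free W.
  apply: row_free_col_mx fLT _ _; first by rewrite -mulmxA BT0 mulmx0.
  by rewrite /row_free mxrankMfree.
(* With F_H = I, a null vector of the closed-loop R is also a null vector of B^*. *)
exists K, 0, 1%:M; split; last first.
  by rewrite hE' rank_gram (eqP fW) -(rank_ct (TB ^t* *m E)) ctM trmxCK -hE.1.
have hR' : psdmx (Rd + B *m 1%:M *m B ^t*).
  rewrite mulmx1; apply: (psdD hR).
  by rewrite -{1}[B]trmxCK; exact: psd_gram.
have hRk (x : 'cV_n) : (Rd + B *m 1%:M *m B ^t*) *m x = 0 ->
    Rd *m x = 0 /\ B ^t* *m x = 0.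
  rewrite mulmx1 -{1}[B]trmxCK => h.
  by have [Rx /gram_eq0 Bx] := psdD_ker hR (psd_gram (B ^t*)) h.
have hEk (x : 'cV_n) : (E + B *m K *m B ^t*) *m x = 0 ->
    B ^t* *m x = 0 -> E *m x = 0.
  by move=> h Bx; move: h; rewrite mulmxDl -(mulmxA _ (B ^t*)) Bx mulmx0 addr0.
have hJ' : J + B *m 0 *m B ^t* = - (J + B *m 0 *m B ^t*) ^t*.
  by rewrite mulmx0 mul0mx addr0.
have hpE : psdmx (E + B *m K *m B ^t*).
  by rewrite hE'; exact: psd_gram.
rewrite /stabilizing_feedback.
suff [h1 h2 h3] : [/\ regular_pair (E + B *m K *m B ^t*)
     (J + B *m 0 *m B ^t* - (Rd + B *m 1%:M *m B ^t*)),
     exists2 nu : nat, pencil_index (E + B *m K *m B ^t*)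
     (J + B *m 0 *m B ^t* - (Rd + B *m 1%:M *m B ^t*)) nu & (nu <= 1)%N &
     forall l : C, finite_eigenvalue (E + B *m K *m B ^t*)
     (J + B *m 0 *m B ^t* - (Rd + B *m 1%:M *m B ^t*)) l -> complex.Re l < 0].
  split; [by rewrite ct0 ct1 oppr0| exact: h1| exact: h2| exact: h3|].
  exact: conj hpE hR'.
apply: dissipative_stable => //; last first.
  move=> s x hs /hRk[Rx Bx]; rewrite mulmx0 mul0mx addr0 mulmxDl.
  rewrite -(mulmxA _ (B ^t*)) Bx mulmx0 addr0 => Jx.
  apply: ct_eq0; apply: (rank_eq_dim _).1.
    by apply: (hc s); apply: re_eq0; rewrite hs subrr.
  rewrite mul_mx_row -row_mx0; congr row_mx; last first.
    by apply: ct_eq0; rewrite ctM trmxCK.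
  apply: ct_eq0; rewrite ctM trmxCK !ctD !ctN ctZ hs -hE.1 -hR.1.
  have -> : J ^t* = - J by rewrite {2}hJ opprK.
  rewrite scaleNr opprK !mulmxDl !mulNmx Jx Rx oppr0 addr0 -scalemxAl.
  by rewrite addrC subrr.
move=> x z Ex Ax.
(* The closed-loop form x^* A x equals x^* E z, which is 0 because E is Hermitian and E x = 0. *)
have [hpR hpA] : (Rd + B *m 1%:M *m B ^t*) *m x = 0 /\
    x ^t* *m (J + B *m 0 *m B ^t* - (Rd + B *m 1%:M *m B ^t*))
    = - ((J + B *m 0 *m B ^t* - (Rd + B *m 1%:M *m B ^t*)) *m x) ^t*.
  apply: dissipative_null => //.
  by rewrite -mulmxA Ax mulmxA hpE.1 -ctM Ex ct0 mul0mx.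
have [Rx Bx] := hRk x hpR.
have xB : x ^t* *m B = 0 by apply: ct_eq0; rewrite ctM trmxCK.
have xA : x ^t* *m A = - z ^t* *m (W ^t* *m W).
  have <- : x ^t* *m (J + B *m 0 *m B ^t* - (Rd + B *m 1%:M *m B ^t*))
      = x ^t* *m A.
    rewrite mulmx0 mul0mx addr0 mulmx1 opprD addrA [LHS]mulmxDr mulmxN.
    by rewrite (mulmxA (x ^t*) B) xB mul0mx oppr0 addr0.
  by rewrite hpA Ax ctM -hE' -hpE.1 mulNmx.
have Exz := hEk x Ex Bx.
have xM : x ^t* *m row_mx E B = 0.
  have xE : x ^t* *m E = 0 by rewrite hE.1 -ctM Exz ct0.
  by rewrite mul_mx_row xB xE row_mx0.
have := right_null_mul hS; rewrite mul_col_mx -col_mx0 => /eq_col_mx[ES BS].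
have xAS : x ^t* *m A *m S = 0.
  by rewrite xA -hE' -mulmxA mulmxDl ES add0r -(mulmxA _ (B ^t*)) BS !mulmx0.
have /submxP[w hw] : (x ^t* <= Nd)%MS.
  by rewrite sub_capmx; apply/andP; split; apply/sub_kermxP; rewrite // mulmxA.
(* The squared norm of v is x^* A Y0 v = - z^* W^* W Y0 v, and W Y0 v = [0; D v] = 0 by the choice
   of D. *)
have uAY : x ^t* *m A *m Y0 = 0.
  set v := (x ^t* *m A *m Y0) ^t*.
  have Dv : D *m v = 0.
    have -> : v = D0 ^t* *m w ^t* by rewrite -ctM /v hw /D0 !mulmxA.
    by rewrite mulmxA hD mul0mx.
  apply: ct_eq0; apply: sqnorm_eq0; rewrite -/v trmxCK {1}xA -!mulmxA.
  rewrite (mulmxA W) mul_col_mx LY0 -(mulmxA D) BY0 mulmx1 mul_col_mx Dv mul0mx.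
  by rewrite col_mx0 !mulmx0.
(* A null vector y of [TB ^t* *m E] splits into parts in the ranges of S and Y0, both killed by x^*
   A. *)
apply: ct_eq0; apply: hreg => //; apply: submx_kerP => y hy.
have L0y : L0 *m y = 0.
  have hTE : TB ^t* *m E = TB ^t* *m (L0 ^t* *m L0).
    have := congr1 (fun M : 'M_(n, k) => M ^t*) hL0.
    by rewrite /= ctM (ctM (L0 ^t*)) trmxCK (ctM E) -hE.1 => ->.
  have h : (L0 *m TB) ^t* *m (L0 *m y) = 0.
    by rewrite -[RHS]hy hTE ctM !mulmxA.
  apply: ct_eq0; apply: (row_free_inj fLT); rewrite mul0mx.
  by apply: ct_eq0; rewrite ctM trmxCK.
have [s hs] : exists s, y - Y0 *m (B ^t* *m y) = S *m s.
  apply/hS.2; set d := y - _.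
  have Bd : B ^t* *m d = 0 by rewrite mulmxBr (mulmxA _ Y0) BY0 mul1mx subrr.
  have Ld : L0 *m d = 0 by rewrite mulmxBr (mulmxA _ Y0) LY0 mul0mx L0y subrr.
  have Ed : E *m d = 0.
    have := congr1 (mulmx^~ d) hE0; rewrite /= mulmxDl -(mulmxA _ (B ^t*)) Bd.
    by rewrite mulmx0 addr0 -mulmxA Ld mulmx0.
  by rewrite mul_col_mx Ed Bd col_mx0.
have -> : y = S *m s + Y0 *m (B ^t* *m y) by rewrite -hs subrK.
by rewrite mulmxDr (mulmxA _ S) xAS mul0mx add0r (mulmxA _ Y0) uAY mul0mx.
Qed.

(** A is injective on the range of S: if A x = 0 there, then x^* A = 0 by dissipativity and x^*
    [E B] = 0, so x = 0. *)
Lemma rank_dissipative_mul (n m k k' : nat) (E J Rd : 'M[C]_n) (B : 'M_(n, m))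
    (TB : 'M_(n, k)) (S : 'M_(n, k')) :
  psdmx E -> psdmx Rd -> J = - J ^t* ->
  right_null_basis (col_mx E (B ^t*)) S ->
  regularizable E (J - Rd) B TB -> \rank ((J - Rd) *m S) = k'.
Proof.
move=> hE hR hJ hS hreg; rewrite -rank_ct; apply/rank_eq_dim => u hu.
have := right_null_mul hS; rewrite mul_col_mx -col_mx0 => /eq_col_mx[ES BS].
set x := S *m u ^t*.
have Ax : (J - Rd) *m x = 0 by apply: ct_eq0; rewrite mulmxA ctM trmxCK.
have [_ xA] : Rd *m x = 0 /\ x ^t* *m (J - Rd) = - ((J - Rd) *m x) ^t*.
  by apply: dissipative_null => //; rewrite -mulmxA Ax mulmx0.
have x0 : x ^t* = 0.
  apply: hreg; last by rewrite xA Ax ct0 oppr0 sub0mx.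
  apply: ct_eq0; rewrite ctM trmxCK ct_row_mx -hE.1 mul_col_mx.
  by rewrite !mulmxA ES BS !mul0mx col_mx0.
have fS : row_free (S ^t*) by rewrite /row_free rank_ct hS.1.
by apply: (row_free_inj fS); rewrite mul0mx -[u]trmxCK -ctM.
Qed.

Lemma rank_row_mx_ct (n m k' : nat) (E : 'M[C]_n) (B : 'M_(n, m))
    (S : 'M_(n, k')) :
  psdmx E -> right_null_basis (col_mx E (B ^t*)) S ->
  k' = (n - \rank (row_mx E B))%N.
Proof.
move=> hE /rank_right_null ->.
by rewrite -(rank_ct (row_mx E B)) ct_row_mx -hE.1.
Qed.

(* For the last bound: the form (x, y) |-> x^* A' y of the closed loop is
   nondegenerate on the kernel of the closed-loop E, which contains the range of
   S, and null_part is orthogonal to that range. *)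
Lemma feedback_necessary (n m k k' : nat) (E J Rd : 'M[C]_n) (B : 'M_(n, m))
    (TB : 'M_(n, k)) (S : 'M_(n, k')) (K FS FH : 'M_m) :
  J = - J ^t* -> left_null_basis B TB ->
  right_null_basis (col_mx E (B ^t*)) S ->
  stabilizing_feedback E J Rd B K FS FH ->
  [/\ regularizable E (J - Rd) B TB,
      forall s : C, complex.Re s = 0 -> \rank (row_mx (J - Rd - s *: E) B) = n,
      (\rank (TB ^t* *m E) <= \rank (E + B *m K *m B ^t*)%R)%N &
      (\rank (E + B *m K *m B ^t*)%R + k' + \rank (null_part E (J - Rd) B S)
       <= n)%N].
Proof.
move=> hJ hTB hS [[hFS hFH] _ [nu hnu nu1] heig [hE' hR']].
set E' := E + B *m K *m B ^t* in hnu heig hE' *.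
set R' := Rd + B *m FH *m B ^t* in hnu heig hR' *.
set J' := J + B *m FS *m B ^t* in hnu heig *.
have hJ' : J' = - J' ^t*.
  by rewrite /J' ctD !ctM trmxCK opprD -hJ mulmxA {1}hFS mulmxN mulNmx.
have hA' : J' - R' = J - Rd + B *m (FS - FH) *m B ^t*.
  by rewrite /J' /R' mulmxBr mulmxBl opprD addrACA.
(* Left annihilators of B do not see the feedback. *)
have uB0 p (u : 'M_(p, n)) : u *m B = 0 -> u *m E' = u *m E /\
    u *m (J' - R') = u *m (J - Rd).
  move=> h; rewrite hA' /E'.
  have uBB (X : 'M_n) (Y : 'M_m) : u *m (X + B *m Y *m B ^t*) = u *m X.
    by rewrite mulmxDr !mulmxA h !mul0mx addr0.
  by rewrite !uBB.
(* The index criterion for row vectors, obtained from the column version by dissipativity. *)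
have left_crit (u : 'rV_n) : u *m E' = 0 -> (u *m (J' - R') <= E')%MS -> u = 0.
  move=> uE /submxP[w hw]; set x := u ^t*.
  have Ex : E' *m x = 0 by rewrite hE'.1 -ctM uE ct0.
  have xu : x ^t* = u by rewrite trmxCK.
  have [_ hAx] : R' *m x = 0 /\ x ^t* *m (J' - R') = - ((J' - R') *m x) ^t*.
    by apply: dissipative_null => //; rewrite xu hw -mulmxA Ex mulmx0.
  apply: ct_eq0; apply: (index_le1_kernel hnu nu1 (z := - w ^t*)) => //.
  by rewrite -/x mulmxN {1}hE'.1 -ctM -hw -xu hAx ctN trmxCK opprK.
split.
- move=> u; rewrite mul_mx_row -row_mx0 => /eq_row_mx[uE uB] uA.
  have [uE' uA'] := uB0 _ u uB.
  apply: left_crit; first by rewrite uE'.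
  rewrite uA'; apply: (submx_trans uA).
  by rewrite -(uB0 _ _ (left_null_mul hTB)).1 submxMl.
- move=> s hs; apply/rank_eq_dim => u; rewrite mul_mx_row -row_mx0.
  move=> /eq_row_mx[uA uB]; have [uE' uA'] := uB0 _ u uB.
  apply/eqP; apply: contraT => u0.
  have : complex.Re s < 0; last by rewrite hs ltxx.
  apply: heig; rewrite /finite_eigenvalue; apply/eqP/det0P; exists u => //.
  rewrite mulmxBr -scalemxAr uE' uA' scalemxAr -mulmxBr -opprB mulmxN uA.
  by rewrite oppr0.
- by rewrite -(uB0 _ _ (left_null_mul hTB)).1 mxrankM_maxr.
have := right_null_mul hS; rewrite mul_col_mx -col_mx0 => /eq_col_mx[ES BS].
set Nd := null_part _ _ _ _.
pose X := row_base Nd; pose Z := (row_base (kermx E')) ^t*.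
have XN : (X <= Nd)%MS by rewrite eq_row_base.
have XM : X *m row_mx E B = 0.
  by apply/sub_kermxP; apply: submx_trans XN (capmxSr _ _).
have XA : X *m ((J - Rd) *m S) = 0.
  by apply/sub_kermxP; apply: submx_trans XN (capmxSl _ _).
move: XM; rewrite mul_mx_row -row_mx0 => /eq_row_mx[XE XB].
have [XE' XA'] := uB0 _ X XB.
have ES' : E' *m S = 0 by rewrite mulmxDl ES -mulmxA BS mulmx0 addr0.
have hZ p (Y : 'M_(n, p)) : E' *m Y = 0 -> exists Y', Y = Z *m Y'.
  move=> hY; have /submxP[Y' hY'] : (Y ^t* <= row_base (kermx E'))%MS.
    by rewrite eq_row_base; apply/sub_kermxP; rewrite hE'.1 -ctM hY ct0.
  by exists (Y' ^t*); rewrite -[Y]trmxCK hY' ctM.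
have [Y hY] := hZ _ S ES'.
have hP : \rank (X *m (J' - R') *m Z) = \rank Nd.
  apply/rank_eq_dim => w hw.
  have fX : row_free X by exact: row_base_free.
  apply: (row_free_inj fX); rewrite mul0mx; apply: left_crit.
    by rewrite -mulmxA XE' XE mulmx0.
  apply: submx_kerP => y /hZ[c ->].
  have -> : w *m X *m (J' - R') *m (Z *m c) = w *m (X *m (J' - R') *m Z) *m c.
    by rewrite !mulmxA.
  by rewrite hw mul0mx.
(* Both factors have inner dimension n - rank E', which therefore bounds the sum of their ranks. *)
have /mulmx0_rank_max : (X *m (J' - R') *m Z) *m Y = 0.
  by rewrite -mulmxA -hY XA' -mulmxA.
have : (k' <= \rank Y)%N by have := mxrankM_maxr Z Y; rewrite -hY hS.1.
rewrite hP; have := mxrank_ker E'; have := rank_leq_row E'.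
move: (\rank Nd) (\rank Y) => d y.
move: (\rank (kermx E')) (\rank E') => z e; lia.
Qed.

End Dissipative.

(** * Solvability criterion and attainable ranks *)

Theorem theorem15 (R : realType) (n m : nat)
    (E J Rd : 'M[R[i]]_n) (B : 'M[R[i]]_(n, m))
    (hE : psdmx E) (hRd : psdmx Rd) (hJ : J = - J ^t*) (hB : \rank B = m)
    (* any choice of the nullspace matrices *)
    (kB : nat) (TB : 'M[R[i]]_(n, kB)) (hTB : left_null_basis B TB)
    (kEB : nat) (TEB : 'M[R[i]]_(n, kEB))
    (hTEB : left_null_basis (row_mx E B) TEB)
    (kS : nat) (S : 'M[R[i]]_(n, kS))
    (hS : right_null_basis (TEB ^t* *m (J - Rd)) S)
    (kS' : nat) (S' : 'M[R[i]]_(n, kS'))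
    (hS' : right_null_basis (col_mx E (B ^t*)) S')
    (kT' : nat) (T' : 'M[R[i]]_(n, kT'))
    (hT' : left_null_basis ((J - Rd) *m S') T') :
  let cond_a := \rank (row_mx E (row_mx (J - Rd) B)) = n in
  let cond_b :=
    (\rank (TB ^t* *m E *m S))%:Z = (\rank (row_mx E B))%:Z - (\rank B)%:Z in
  let cond_c :=
    forall s : R[i], complex.Re s = 0 -> \rank (row_mx (J - Rd - s *: E) B) = n in
  ((exists K FS FH : 'M[R[i]]_m, stabilizing_feedback E J Rd B K FS FH)
     <-> [/\ cond_a, cond_b & cond_c])
  /\
  ([/\ cond_a, cond_b & cond_c] ->
   forall r : int,
     (exists K FS FH : 'M[R[i]]_m,
        stabilizing_feedback E J Rd B K FS FH /\
        (\rank (E + B *m K *m B ^t*)%R)%:Z = r)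
     <-> (\rank (row_mx E B))%:Z - (\rank B)%:Z <= r
         <= (\rank (T' ^t* *m row_mx E B))%:Z).
Proof.
move=> cond_a cond_b cond_c.
have hg := rank_left_null_row_mx E hTB; rewrite hB in hg.
have hT := rank_left_null_mul (row_mx E B) hT'.
have hk := rank_row_mx_ct hE hS'.
have hbE : cond_b <-> \rank (TB ^t* *m E *m S) = \rank (TB ^t* *m E).
  by rewrite /cond_b -hg hB; split; lia.
have habc : [/\ cond_a, cond_b & cond_c] <->
    regularizable E (J - Rd) B TB /\ cond_c.
  by rewrite (regularizableP hTB hTEB hS) -hbE; split=> [[]|[[]]].
have hsuff rho : [/\ cond_a, cond_b & cond_c] ->
    (rho <= m - \rank (null_part E (J - Rd) B S'))%N ->
    exists K FS FH : 'M_m, stabilizing_feedback E J Rd B K FS FH /\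
      \rank (E + B *m K *m B ^t*)%R = (\rank (TB ^t* *m E) + rho)%N.
  by move=> /habc[hreg hc]; exact: feedback_exists.
(* The upper bound on r is rank [E B] minus the dimension of the null part, since (J - R) S' has
   full column rank n - rank [E B]. *)
have hrank : [/\ cond_a, cond_b & cond_c] ->
    (\rank (T' ^t* *m row_mx E B) + \rank (null_part E (J - Rd) B S')
     = \rank (row_mx E B))%N.
  move=> /habc[hreg _].
  rewrite [LHS]hT (rank_dissipative_mul hE hRd hJ hS' hreg) hk.
  by rewrite subKn // rank_leq_row.
split; first split.
- move=> [K [FS [FH hst]]]; apply/habc.
  by have [] := feedback_necessary hJ hTB hS' hst.
- move=> habc'; have [K [FS [FH [hst _]]]] := hsuff 0%N habc' (leq0n _).
  by exists K, FS, FH.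
move=> habc' r; have hr := hrank habc'; split.
  move=> [K [FS [FH [hst <-]]]].
  have [_ _ h1 h2] := feedback_necessary hJ hTB hS' hst.
  have hle := rank_leq_row (row_mx E B).
  rewrite hB -hg; apply/andP; split; lia.
rewrite hB -hg => /andP[r1 r2].
rewrite -hg in hr.
(* A negative r violates the lower bound, which is a rank. *)
case: r r1 r2 => [r|r] r1 r2; last by lia.
have [|K [FS [FH [hst hrk]]]] := hsuff (r - \rank (TB ^t* *m E))%N habc'.
  by lia.
by exists K, FS, FH; split=> //; rewrite hrk; lia.
Qed.
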